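(* Let $0\leq m<M$ be real numbers and let $f:[0,\infty)\to\mathbb{R}$ be a superquadratic function. Then for all $x,y\in[m,M]$ with $x\neq y$, assuming that all integrals appearing below exist (as Lebesgue integrals of integrable functions), the following two chains of inequalities hold: $$f\left(m+M-\frac{x+y}{2}\right)+2\int_{0}^{1/2}f(u|x-y|)\,\mathrm{d}u\leq\frac{1}{y-x}\int_{x}^{y}f(m+M-u)\,\mathrm{d}u\leq f(m)+f(M)-\frac{f(x)+f(y)}{2}-(\beta(x)+\beta(y))-2\int_{0}^{1}(1-u)f(u|x-y|)\,\mathrm{d}u$$ and $$f\left(m+M-\frac{x+y}{2}\right)+2\int_{0}^{1/2}f(u|x-y|)\,\mathrm{d}u\leq f(m)+f(M)-\frac{1}{y-x}\int_{x}^{y}\big(f(u)+2\beta(u)\big)\,\mathrm{d}u\leq f(m)+f(M)-f\left(\frac{x+y}{2}\right)-\frac{2}{y-x}\int_{x}^{y}\beta(u)\,\mathrm{d}u-2\int_{0}^{1/2}f(u|x-y|)\,\mathrm{d}u.$$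
   Context: A function $f:[0,\infty)\to\mathbb{R}$ is called superquadratic if for every $x\geq 0$ there exists a constant $C_x\in\mathbb{R}$ such that $f(y)\geq f(x)+C_x(y-x)+f(|y-x|)$ for all $y\geq 0$. For given $0\le m<M$ and $f$, the function $\beta$ is defined by $$\beta(t)=\frac{t-m}{M-m}f(M-t)+\frac{M-t}{M-m}f(t-m),\qquad t\in[m,M].$$ When $x>y$, $\int_x^y$ denotes the oriented integral $-\int_y^x$. *)

(* Defs.v *)
From HB Require Import structures.
From mathcomp Require Import all_boot all_order all_algebra.
From mathcomp Require Import all_classical all_reals all_analysis.

Set Implicit Arguments.
Unset Strict Implicit.
Unset Printing Implicit Defensive.

Import Order.TTheory GRing.Theory Num.Theory.
Import numFieldNormedType.Exports.

Local Open Scope classical_set_scope.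
Local Open Scope ring_scope.

(* A function on [0, +oo) is represented by a total function f : R -> R, of
   which only the values at nonnegative arguments are constrained or used. *)
Definition superquadratic (R : realType) (f : R -> R) : Prop :=
  forall x : R, 0 <= x ->
    exists C : R, forall y : R, 0 <= y ->
      f x + C * (y - x) + f `|y - x| <= f y.

(* Meaningful for m < M and t in [m, M]: there both M - t and t - m are
   nonnegative. *)
Definition beta (R : realType) (m M : R) (f : R -> R) (t : R) : R :=
  (t - m) / (M - m) * f (M - t) + (M - t) / (M - m) * f (t - m).

(* lebesgue_measure lives on the Borel sigma-algebra only; its completion is
   used so that integrable means Lebesgue measurable with finite integral of
   the absolute value.
   Rintegral is a total operator (it defaults to 0), so existence of the
   integral has to be asserted separately, by integrable_between. *)
Definition oriented_integral (R : realType) (a b : R) (g : R -> R) : R :=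
  if a <= b then \int[completed_lebesgue_measure]_(u in `[a, b]) g u
  else - \int[completed_lebesgue_measure]_(u in `[b, a]) g u.

Definition integrable_between (R : realType) (a b : R) (g : R -> R) : Prop :=
  (@completed_lebesgue_measure R).-integrable
    `[Num.min a b, Num.max a b] (EFin \o g).

(* Main.v *)
Require Import Defs.
From HB Require Import structures.
From mathcomp Require Import all_boot all_order all_algebra.
From mathcomp Require Import all_classical all_reals all_analysis.
From mathcomp Require Import measurable_realfun ring lra.

Set Implicit Arguments.
Unset Strict Implicit.
Unset Printing Implicit Defensive.

Import Order.TTheory GRing.Theory Num.Theory.
Import numFieldNormedType.Exports.

Local Open Scope classical_set_scope.
Local Open Scope ring_scope.

(** A superquadratic [f] satisfies a two-point Jensen inequality with a gain:
    applying the defining inequality at [z = (1 - u) a + u b] with [y = a] and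
    [y = b] and averaging with weights [1 - u] and [u] cancels the slope [C]
    and leaves
      [f z <= (1 - u) f a + u f b - (1 - u) f (u |b - a|) - u f ((1 - u) |b - a|)]
    ([superquadratic_segment]). Three consequences carry the theorem.

    With [a = m], [b = M], the right-hand side at [t] is the chord of [f] minus
    [beta t]. The function [beta] is invariant under [t |-> m + M - t], while
    the chord values at [t] and [m + M - t] add up to [f m + f M]; adding the
    two instances gives [f (m + M - t) <= f m + f M - f t - 2 beta t]
    ([superquadratic_mercer]).

    Averaging the inequality over [u] in [[0, 1]] gives an upper bound for the
    mean of [f] over a segment ([superquadratic_hermite_hadamard_right]); pairing
    the points of the segment that are symmetric about its midpoint gives a
    lower bound ([superquadratic_hermite_hadamard_left]).

    The first chain is the lower and the upper bound for the segment from
    [m + M - x] to [m + M - y], the end point terms being then estimated by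
    [superquadratic_mercer]. In the second chain the first step integrates
    [superquadratic_mercer] over the segment, and the last step is the lower
    bound for the segment from [x] to [y], where [f] is integrable as the
    difference of [f + 2 beta] and [2 beta].

    A superquadratic function need not be Borel (every function with values in
    [[-2, -1]] is superquadratic), so the means are taken for the completed
    Lebesgue measure, and continuity cannot be used to change variables. Only
    affine changes of variables are needed. They are obtained from the outer
    measure: an affine bijection of slope [a] carries coverings by open
    intervals to coverings by open intervals and multiplies total lengths by a
    constant, hence divides the outer measure of a preimage by [|a|]
    ([clm_affine]). Since Caratheodory measurability is expressed by the outer
    measure alone, it is preserved too ([caratheodory_affine]). Once every mean
    is written as an integral over [[0, 1]] ([mean_oriented_integral]), both
    orientations [x < y] and [y < x] are treated together. *)

Local Notation clm := completed_lebesgue_measure.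
Local Notation clmT R := (caratheodory_type (mu_ext (wlength (@idfun R)))).

(** * Affine maps and the completed Lebesgue measure *)

Lemma is_open_itv_affine (R : realType) (a b : R) (I : set R) : a != 0 ->
  is_open_itv I -> is_open_itv ((fun u => a * u + b) @^-1` I) /\
  wlength idfun ((fun u => a * u + b) @^-1` I) =
    ((`|a|^-1)%:E * wlength idfun I)%E.
Proof.
move=> a0 [[p q] /= ->].
have lenE (c d c' d' : R) : (d' - c') = `|a|^-1 * (d - c) ->
    wlength idfun `]c', d'[%classic =
    ((`|a|^-1)%:E * wlength idfun `]c, d[%classic)%E.
  move=> e; rewrite !wlength_itv/= !lte_fin -(subr_gt0 c') -(subr_gt0 c) e.
  rewrite pmulr_rgt0 ?invr_gt0 ?normr_gt0//.
  by case: ifPn => _; rewrite ?mule0// -EFinD -EFinM e.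
have [ap|an|/eqP] := ltgtP a 0; last by rewrite (negbTE a0).
- have -> : (fun u => a * u + b) @^-1` `]p, q[ =
      `](q - b) / a, (p - b) / a[%classic.
    apply/seteqP; split => u /=; rewrite !in_itv/= ltr_ndivrMr// ltr_ndivlMr//;
    by rewrite ltrBlDr ltrBrDr mulrC andbC.
  split; first by exists ((q - b) / a, (p - b) / a).
  by apply: lenE; rewrite ltr0_norm// invrN; field.
- have -> : (fun u => a * u + b) @^-1` `]p, q[ =
      `](p - b) / a, (q - b) / a[%classic.
    apply/seteqP; split => u /=; rewrite !in_itv/= ltr_pdivrMr// ltr_pdivlMr//;
    by rewrite ltrBlDr ltrBrDr mulrC.
  split; first by exists ((p - b) / a, (q - b) / a).
  by apply: lenE; rewrite gtr0_norm//; field.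
Qed.

(** Pulling back a covering by open intervals gives one inequality; the inverse
    affine map gives the other one in [clm_affine]. *)
Lemma le_clm_affine (R : realType) (a b : R) (A : set R) : a != 0 ->
  (@clm R ((fun u => a * u + b)%R @^-1` A) <= (`|a|^-1)%:E * @clm R A)%E.
Proof.
move=> a0; rewrite [clm A]outer_measure_open_itv_cover.
have a'0 : 0 < `|a|^-1 by rewrite invr_gt0 normr_gt0.
rewrite -ereal_inf_pZl//.
apply: le_ereal_inf_tmp => _ [_ [F [Fitv AF] <-] <-].
rewrite [leLHS]outer_measure_open_itv_cover.
rewrite -nneseriesZl; last by move=> i _; exact: wlength_ge0.
apply: ereal_inf_lbound => /=.
exists (fun k => (fun u => a * u + b) @^-1` F k).
  split; first by move=> k; exact: (is_open_itv_affine _ _ _).1.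
  by rewrite -preimage_bigcup; exact: preimage_subset.
by apply: eq_eseriesr => k _; exact: (is_open_itv_affine _ _ _).2.
Qed.

Lemma preimage_affineK (R : realType) (a b : R) (A : set R) : a != 0 ->
  (fun u => a^-1 * u + - (a^-1 * b)) @^-1` ((fun u => a * u + b) @^-1` A) = A.
Proof.
move=> a0; rewrite -comp_preimage (_ : _ \o _ = id) ?preimage_id//.
by apply/funext => u /=; field.
Qed.

Lemma preimage_affineVK (R : realType) (a b : R) (A : set R) : a != 0 ->
  (fun u => a * u + b) @^-1` ((fun u => a^-1 * u + - (a^-1 * b)) @^-1` A) = A.
Proof.
move=> a0; rewrite -comp_preimage (_ : _ \o _ = id) ?preimage_id//.
by apply/funext => u /=; field.
Qed.

Lemma clm_affine (R : realType) (a b : R) (A : set R) : a != 0 ->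
  @clm R ((fun u => a * u + b)%R @^-1` A) = ((`|a|^-1)%:E * @clm R A)%E.
Proof.
move=> a0; apply/eqP; rewrite eq_le le_clm_affine//=.
have := @le_clm_affine R a^-1 (- (a^-1 * b)) ((fun u => a * u + b) @^-1` A).
rewrite preimage_affineK// invr_eq0 => /(_ a0); rewrite normfV invrK.
by rewrite lee_pdivrMl ?normr_gt0.
Qed.

(** An arbitrary test set is itself a preimage under the affine bijection, so the
    splitting condition for the preimage of [A] is the one for [A], multiplied by
    [|a|^-1]. *)
Lemma caratheodory_affine (R : realType) (a b : R) (A : set R) : a != 0 ->
  (mu_ext (wlength (@idfun R))).-caratheodory A ->
  (mu_ext (wlength (@idfun R))).-caratheodory ((fun u => a * u + b) @^-1` A).
Proof.
move=> a0 mA X.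
rewrite -(@preimage_affineVK _ a b X)// preimage_setC -!preimage_setI.
rewrite ![mu_ext _ (_ @^-1` _)](clm_affine _ _ a0) -ge0_muleDr ?mu_ext_ge0//.
by congr (_ * _)%E; exact: mA.
Qed.

Lemma measurable_affine (R : realType) (a b : R) : a != 0 ->
  measurable_fun [set: clmT R] ((fun u => a * u + b) : clmT R -> clmT R).
Proof. by move=> a0 _ A mA; rewrite setTI; exact: caratheodory_affine. Qed.

Lemma ge0_integral_affine (R : realType) (a b : R) (D : set (clmT R))
    (g : R -> \bar R) : a != 0 -> measurable D ->
  measurable_fun D (g : clmT R -> _) -> (forall u, 0 <= g u)%E ->
  (\int[@clm R]_(u in (fun u => a * u + b)%R @^-1` D) g (a * u + b)%R =
   (`|a|^-1)%:E * \int[@clm R]_(u in D) g u)%E.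
Proof.
move=> a0 mD mg g0.
have k0 : 0 <= `|a|^-1 by rewrite invr_ge0.
pose phi : clmT R -> clmT R := fun u => a * u + b.
have mphi : measurable_fun setT phi by exact: measurable_affine.
transitivity (\int[pushforward (@clm R) phi]_(u in D) g u)%E.
  by rewrite ge0_integral_pushforward.
transitivity (\int[mscale (NngNum k0) (@clm R)]_(u in D) g u)%E.
  apply: eq_measure_integral => // A mA AD.
  exact: clm_affine.
by rewrite ge0_integral_mscale.
Qed.

Lemma integrable_affine (R : realType) (a b : R) (D : set (clmT R))
    (g : R -> R) : a != 0 -> measurable D ->
  (@clm R).-integrable D (EFin \o g) ->
  (@clm R).-integrable ((fun u => a * u + b)%R @^-1` D)
    (EFin \o (fun u => g (a * u + b))).
Proof.
move=> a0 mD /integrableP[mg ig]; apply/integrableP; split.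
  pose phi : clmT R -> clmT R := fun u => a * u + b.
  apply: (@measurable_comp _ _ _ _ _ _ D (EFin \o g) _ phi) => //.
  - by move=> _ [u Du <-].
  - have mphi : measurable_fun setT phi by exact: measurable_affine.
    exact: measurable_funS mphi.
have mng : measurable_fun D (fun u : clmT R => `|(g u)%:E|)%E.
  exact: measurableT_comp.
rewrite (@ge0_integral_affine _ a b D (fun u => `|(g u)%:E|)%E a0 mD mng)//.
by apply: lte_mul_pinfty => //; rewrite lee_fin invr_ge0.
Qed.

Lemma Rintegral_affine (R : realType) (a b : R) (D : set (clmT R))
    (g : R -> R) : a != 0 -> measurable D ->
  (@clm R).-integrable D (EFin \o g) ->
  \int[@clm R]_(u in (fun u => a * u + b)%R @^-1` D) g (a * u + b) =
  `|a|^-1 * \int[@clm R]_(u in D) g u.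
Proof.
move=> a0 mD ig; rewrite /Rintegral.
have mg : measurable_fun D (EFin \o (g : clmT R -> R)).
  exact: measurable_int ig.
rewrite -[X in X * _]/(fine (`|a|^-1)%:E) -fineM//; last first.
  exact: integrable_fin_num ig.
have fN : (\int[@clm R]_(u in D) ((EFin \o g)^\- u))%E \is a fin_num.
  exact: (integrable_fin_num mD (integrable_funeneg mD ig)).
congr fine; rewrite [in LHS]integralE [in RHS]integralE.
rewrite muleBr//; last by apply: fin_num_adde_defl; rewrite fin_numN.
congr (_ - _)%E.
  have := @ge0_integral_affine _ a b D (EFin \o g)^\+%E a0 mD
    (measurable_funepos mg) (funepos_ge0 _).
  apply: etrans; apply: eq_integral => u _.
  by rewrite !funeposE.
have := @ge0_integral_affine _ a b D (EFin \o g)^\-%E a0 mD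
  (measurable_funeneg mg) (funeneg_ge0 _).
apply: etrans; apply: eq_integral => u _.
by rewrite !funenegE.
Qed.

(** * Means over segments as integrals over the unit interval *)

Lemma measurable_itv_clm (R : realType) (i : interval R) :
  measurable ([set` i] : set (clmT R)).
Proof. by apply: sub_caratheodory; exact: (@measurable_itv R i). Qed.

(** The slope [y - x] may be negative, so this covers both orientations. *)
Lemma preimage_segment (R : realType) (x y : R) : x != y ->
  (fun u => (y - x) * u + x) @^-1` `[Num.min x y, Num.max x y] = `[0, 1]%classic.
Proof.
move=> xy; apply/seteqP; split => u /=; rewrite !in_itv/=;
  (have [xy'|xy'|/eqP] := ltgtP x y; last by rewrite (negbTE xy)).
- by move=> /andP[h1 h2]; apply/andP; split; nra.
- by move=> /andP[h1 h2]; apply/andP; split; nra.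
- by move=> /andP[h1 h2]; apply/andP; split; nra.
- by move=> /andP[h1 h2]; apply/andP; split; nra.
Qed.

Lemma integrable_unit (R : realType) (x y : R) (g : R -> R) : x != y ->
  integrable_between x y g ->
  (@clm R).-integrable `[0, 1] (EFin \o (fun u => g ((y - x) * u + x))).
Proof.
move=> xy ig; rewrite -(preimage_segment xy).
apply: integrable_affine => //; first by rewrite subr_eq0 eq_sym.
exact: measurable_itv_clm.
Qed.

Lemma mean_oriented_integral (R : realType) (x y : R) (g : R -> R) : x != y ->
  integrable_between x y g ->
  1 / (y - x) * oriented_integral x y g =
  \int[@clm R]_(u in `[0, 1]) g ((y - x) * u + x).
Proof.
move=> xy ig; rewrite -(preimage_segment xy) Rintegral_affine//; last 2 first.
- by rewrite subr_eq0 eq_sym.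
- exact: measurable_itv_clm.
rewrite /oriented_integral; case: (ltgtP x y) xy => // xy _.
  by rewrite gtr0_norm ?subr_gt0// div1r.
by rewrite ltr0_norm ?subr_lt0// div1r invrN mulrN mulNr.
Qed.

(** Both pieces are closed: the shared point [c] has measure zero. *)
Lemma Rintegral_itv_split (R : realType) (p c q : R) (g : R -> R) :
  p <= c <= q -> (@clm R).-integrable `[p, q] (EFin \o g) ->
  \int[@clm R]_(u in `[p, q]) g u =
  \int[@clm R]_(u in `[p, c]) g u + \int[@clm R]_(u in `[c, q]) g u.
Proof.
move=> /andP[pc cq] ig.
have icq : (@clm R).-integrable `[c, q] (EFin \o g).
  apply: integrableS ig; [exact: measurable_itv_clm|exact: measurable_itv_clm|].
  by move=> u /=; rewrite !in_itv/= => /andP[h ->]; rewrite (le_trans pc).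
have -> : \int[@clm R]_(u in `[c, q]) g u = \int[@clm R]_(u in `]c, q]) g u.
  rewrite /Rintegral (@negligible_integral _ _ _ (@clm R) _ [set c])//.
  - congr (fine (integral _ _ _)); apply/seteqP; split => u /=; rewrite !in_itv/=.
      by move=> [/andP[h ->] /eqP uc]; rewrite lt_neqAle h eq_sym uc.
    by move=> /andP[h ->]; rewrite ltW//; split=> // uc; rewrite uc ltxx in h.
  - by rewrite -set_itv1; exact: measurable_itv_clm.
  - exact: measurable_itv_clm.
  - exact: lebesgue_measure_set1.
have pq : `[p, q]%classic = `[p, c] `|` `]c, q]%classic.
  apply/seteqP; split => u /=; rewrite !in_itv/=.
    move=> /andP[h1 h2]; case: (leP u c) => h; [left|right]; rewrite ?h1 ?h2//.
  by move=> [/andP[-> h]|/andP[h ->]]; rewrite ?(le_trans h)// (le_trans pc)// ltW.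
rewrite {1}pq Rintegral_setU//.
- exact: measurable_itv_clm.
- exact: measurable_itv_clm.
- by rewrite -pq.
- apply/disj_setPS => u [] /=; rewrite !in_itv/= => /andP[_ h] /andP[+ _].
  by rewrite ltNge h.
Qed.

Lemma Rintegral_unit_reflect (R : realType) (g : R -> R) :
  (@clm R).-integrable `[0, 1] (EFin \o g) ->
  (@clm R).-integrable `[0, 1] (EFin \o (fun u => g (1 - u))) /\
  \int[@clm R]_(u in `[0, 1]) g (1 - u) = \int[@clm R]_(u in `[0, 1]) g u.
Proof.
move=> ig; have n0 : (-1 : R) != 0 by rewrite oppr_eq0 oner_eq0.
have mI := @measurable_itv_clm R `[0, 1].
have E : (fun u : R => -1 * u + 1) @^-1` `[0, 1] = `[0, 1]%classic.
  by apply/seteqP; split => u /=; rewrite !in_itv/= => /andP[? ?];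
     apply/andP; split; lra.
have gE : (fun u => g (1 - u)) = (fun u => g (-1 * u + 1)).
  by apply/funext => u; congr g; ring.
have := integrable_affine 1 n0 mI ig; have := Rintegral_affine 1 n0 mI ig.
by rewrite E normrN1 invr1 mul1r gE.
Qed.

(** Folding the unit interval at its midpoint lets an inequality between the
    values at symmetric points be integrated over [[0, 1 / 2]]. *)
Lemma Rintegral_unit_symmetrize (R : realType) (g : R -> R) :
  (@clm R).-integrable `[0, 1] (EFin \o g) ->
  (@clm R).-integrable `[0, 1 / 2]
    (EFin \o (fun u => g (1 / 2 + u) + g (1 / 2 - u))) /\
  \int[@clm R]_(u in `[0, 1 / 2]) (g (1 / 2 + u) + g (1 / 2 - u)) =
  \int[@clm R]_(u in `[0, 1]) g u.
Proof.
move=> ig; have n0 : (-1 : R) != 0 by rewrite oppr_eq0 oner_eq0.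
have p0 : (1 : R) != 0 by rewrite oner_eq0.
have mI p q := @measurable_itv_clm R `[p, q].
have sub p q : 0 <= p -> q <= 1 -> (@clm R).-integrable `[p, q] (EFin \o g).
  move=> p0' q1; apply: integrableS ig; [exact: mI|exact: mI|].
  by move=> u /=; rewrite !in_itv/= => /andP[? ?]; apply/andP; split; lra.
have EN : (fun u : R => -1 * u + 1 / 2) @^-1` `[0, 1 / 2] = `[0, 1 / 2]%classic.
  by apply/seteqP; split => u /=; rewrite !in_itv/= => /andP[? ?];
     apply/andP; split; lra.
have EP : (fun u : R => 1 * u + 1 / 2) @^-1` `[1 / 2, 1] = `[0, 1 / 2]%classic.
  by apply/seteqP; split => u /=; rewrite !in_itv/= => /andP[? ?];
     apply/andP; split; lra.
have gN : (fun u => g (1 / 2 - u)) = (fun u => g (-1 * u + 1 / 2)).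
  by apply/funext => u; congr g; ring.
have gP : (fun u => g (1 / 2 + u)) = (fun u => g (1 * u + 1 / 2)).
  by apply/funext => u; congr g; ring.
have iN : (@clm R).-integrable `[0, 1 / 2] (EFin \o (fun u => g (1 / 2 - u))).
  by rewrite gN -EN; apply: integrable_affine => //; apply: sub; lra.
have iP : (@clm R).-integrable `[0, 1 / 2] (EFin \o (fun u => g (1 / 2 + u))).
  by rewrite gP -EP; apply: integrable_affine => //; apply: sub; lra.
have mH := mI 0 (1 / 2).
split; first exact: (integrableD mH iP iN).
rewrite RintegralD// (@Rintegral_itv_split _ 0 (1 / 2) 1)//; last by apply/andP; split; lra.
rewrite addrC gN gP; congr (_ + _).
  rewrite -[in LHS]EN Rintegral_affine//; last by apply: sub; lra.
  by rewrite normrN1 invr1 mul1r.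
rewrite -[in LHS]EP Rintegral_affine//; first by rewrite normr1 invr1 mul1r.
by apply: sub; lra.
Qed.

Lemma clm_segment (R : realType) (p q : R) : p <= q ->
  @clm R `[p, q]%classic = (q - p)%:E.
Proof.
move=> pq; rewrite [LHS](lebesgue_measure_itv `[p, q]) /= lte_fin.
by case: ltgtP pq => // -> _; rewrite subrr.
Qed.

Lemma integrable_cst_segment (R : realType) (p q k : R) : p <= q ->
  (@clm R).-integrable `[p, q] (EFin \o (fun=> k)).
Proof.
move=> pq; apply/integrableP; split; first exact: measurable_cst.
rewrite /= integral_cst; last exact: measurable_itv_clm.
by rewrite [X in (_ * X)%E](clm_segment pq) -EFinM ltry.
Qed.

(** * Pointwise inequalities for superquadratic functions *)

Lemma superquadratic_midpoint (R : realType) (f : R -> R) (c h : R) :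
  superquadratic f -> `|h| <= c ->
  2 * f c + 2 * f `|h| <= f (c + h) + f (c - h).
Proof.
move=> sf; rewrite ler_norml => /andP[h1 h2].
have [|C fC] := sf c; first by lra.
have hP : 0 <= c + h by lra.
have hN : 0 <= c - h by lra.
have := fC _ hP; have := fC _ hN.
rewrite (_ : c - h - c = - h); last by ring.
rewrite (_ : c + h - c = h) ?normrN; last by ring.
lra.
Qed.

(** Jensen's inequality with gain: the slopes of the support inequality at the
    intermediate point cancel in the weighted average. *)
Lemma superquadratic_segment (R : realType) (f : R -> R) (a b u : R) :
  superquadratic f -> 0 <= a -> 0 <= b -> 0 <= u <= 1 ->
  f ((b - a) * u + a) <= (1 - u) * f a + u * f b
    - (1 - u) * f (u * `|b - a|) - u * f ((1 - u) * `|b - a|).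
Proof.
move=> sf a0 b0 /andP[u0 u1]; set z := (b - a) * u + a.
have z0 : 0 <= z by rewrite /z; nra.
have [C fC] := sf _ z0.
have := fC _ a0; have := fC _ b0.
rewrite (_ : b - z = (1 - u) * (b - a)); last by rewrite /z; ring.
rewrite (_ : a - z = u * (a - b)); last by rewrite /z; ring.
rewrite !normrM (ger0_norm u0) (ger0_norm (_ : 0 <= 1 - u)) ?subr_ge0//.
rewrite (distrC a b).
move: (f _) (f _) (f _) (f _) (f _) => r1 r2 r3 r4 r5 h1 h2.
nra.
Qed.

(** With [v = (t - m) / (M - m)], the instances of [superquadratic_segment] at [v]
    and at [1 - v] have the same gain, equal to [beta m M f t], and weights that
    add up to [1] at each end point. *)
Lemma superquadratic_mercer (R : realType) (m M t : R) (f : R -> R) :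
  superquadratic f -> 0 <= m -> m < M -> m <= t <= M ->
  f (m + M - t) <= f m + f M - f t - 2 * beta m M f t.
Proof.
move=> sf m0 mM /andP[mt tM].
have d0 : 0 < M - m by rewrite subr_gt0.
have M0 : 0 <= M by lra.
set v := (t - m) / (M - m).
have v01 : 0 <= v <= 1.
  by rewrite /v divr_ge0 ?(ltW d0) ?subr_ge0//= ler_pdivrMr// mul1r lerD2r.
have w01 : 0 <= 1 - v <= 1 by move/andP: v01 => [? ?]; apply/andP; split; lra.
have dn0 : M - m != 0 by rewrite gt_eqF.
have vE : v * `|M - m| = t - m by rewrite gtr0_norm// /v divfK.
have wE : (1 - v) * `|M - m| = M - t by rewrite mulrBl vE gtr0_norm//; ring.
have := superquadratic_segment sf m0 M0 v01.
have := superquadratic_segment sf m0 M0 w01.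
rewrite subKr vE wE.
rewrite (_ : (M - m) * (1 - v) + m = m + M - t); last by rewrite /v; field.
rewrite (_ : (M - m) * v + m = t); last by rewrite /v; field.
rewrite /beta -/v (_ : (M - t) / (M - m) = 1 - v); last by rewrite /v; field.
lra.
Qed.


(** * Hermite-Hadamard inequalities for superquadratic functions *)

(** The linear term of the support inequality at the midpoint is odd, so it
    disappears when the unit interval is folded at [1 / 2]. *)
Lemma superquadratic_hermite_hadamard_left (R : realType) (f : R -> R) (p q : R) :
  superquadratic f -> 0 <= p -> 0 <= q ->
  (@clm R).-integrable `[0, 1] (EFin \o (fun u => f ((q - p) * u + p))) ->
  (@clm R).-integrable `[0, 1 / 2] (EFin \o (fun u => f (u * `|q - p|))) ->
  f ((p + q) / 2) + 2 * \int[@clm R]_(u in `[0, 1 / 2]) f (u * `|q - p|) <=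
  \int[@clm R]_(u in `[0, 1]) f ((q - p) * u + p).
Proof.
move=> sf p0 q0 iF ih.
have mH := @measurable_itv_clm R `[0, 1 / 2].
have h0 : 0 <= 1 / 2 :> R by lra.
have [iS <-] := Rintegral_unit_symmetrize iF.
have ic := integrable_cst_segment (2 * f ((p + q) / 2)) h0.
have -> : f ((p + q) / 2) =
    \int[@clm R]_(u in `[0, 1 / 2]) (2 * f ((p + q) / 2)).
  by rewrite Rintegral_cst// [X in fine X]clm_segment//=; field.
have i2 : (@clm R).-integrable `[0, 1 / 2]
    (EFin \o (fun u => 2 * f (u * `|q - p|))) by exact: (integrableZl mH 2 ih).
rewrite -RintegralZl// -RintegralD//.
apply: le_Rintegral => //; first exact: (integrableD mH ic i2).
move=> u /=; rewrite in_itv/= => /andP[u0 u1].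
have hE : u * `|q - p| = `|(q - p) * u| by rewrite normrM (ger0_norm u0) mulrC.
have -> : (q - p) * (1 / 2 + u) + p = (p + q) / 2 + (q - p) * u by field.
have -> : (q - p) * (1 / 2 - u) + p = (p + q) / 2 - (q - p) * u by field.
rewrite hE; apply: superquadratic_midpoint => //.
have d : `|q - p| <= p + q.
  by move: p0 q0; clear; rewrite ler_norml => ? ?; apply/andP; split; lra.
by have := ler_pM u0 (normr_ge0 (q - p)) u1 d; rewrite -hE; clear; lra.
Qed.

(** Adding [superquadratic_segment] at [u] and at [1 - u] turns the chord into the
    constant [f p + f q] and makes the gain symmetric; since the reflection
    [u |-> 1 - u] preserves integrals over [[0, 1]], each side of the integrated
    sum is a multiple of a single integral. *)
Lemma superquadratic_hermite_hadamard_right (R : realType) (f : R -> R) (p q : R) :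
  superquadratic f -> 0 <= p -> 0 <= q ->
  (@clm R).-integrable `[0, 1] (EFin \o (fun u => f ((q - p) * u + p))) ->
  (@clm R).-integrable `[0, 1] (EFin \o (fun u => (1 - u) * f (u * `|q - p|))) ->
  \int[@clm R]_(u in `[0, 1]) f ((q - p) * u + p) <=
  (f p + f q) / 2 - 2 * \int[@clm R]_(u in `[0, 1]) ((1 - u) * f (u * `|q - p|)).
Proof.
move=> sf p0 q0 iF iw.
have mI := @measurable_itv_clm R `[0, 1].
pose F u := f ((q - p) * u + p); pose w u := (1 - u) * f (u * `|q - p|).
have FwE u : 0 <= u <= 1 ->
    F u + F (1 - u) <= f p + f q - 2 * (w u + w (1 - u)).
  move=> u01.
  have v01 : 0 <= 1 - u <= 1 by move/andP: u01 => [? ?]; apply/andP; split; lra.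
  have := superquadratic_segment sf p0 q0 u01.
  have := superquadratic_segment sf p0 q0 v01.
  by rewrite /F /w !subKr; lra.
have [iF' F'E] := @Rintegral_unit_reflect R F iF.
have [iw' w'E] := @Rintegral_unit_reflect R w iw.
have ic := integrable_cst_segment (f p + f q) (@ler01 R).
have FE : \int[@clm R]_(u in `[0, 1]) (F u + F (1 - u)) =
    2 * \int[@clm R]_(u in `[0, 1]) F u.
  by rewrite RintegralD// F'E; ring.
have iw2 : (@clm R).-integrable `[0, 1] (EFin \o (fun u => w u + w (1 - u))).
  exact: (integrableD mI iw iw').
have iw4 : (@clm R).-integrable `[0, 1]
    (EFin \o (fun u => 2 * (w u + w (1 - u)))) by exact: (integrableZl mI 2 iw2).
have wE : \int[@clm R]_(u in `[0, 1]) (f p + f q - 2 * (w u + w (1 - u))) =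
    f p + f q - 4 * \int[@clm R]_(u in `[0, 1]) w u.
  rewrite RintegralB// Rintegral_cst// [X in fine X]clm_segment//=.
  by rewrite RintegralZl// RintegralD// w'E; ring.
have : \int[@clm R]_(u in `[0, 1]) (F u + F (1 - u)) <=
    \int[@clm R]_(u in `[0, 1]) (f p + f q - 2 * (w u + w (1 - u))).
  apply: le_Rintegral => //.
  - exact: (integrableD mI iF iF').
  - exact: (integrableB mI ic iw4).
rewrite {}FE {}wE -/(F _) -/(w _); clear; lra.
Qed.

Theorem theorem2p2 (R : realType) (m M : R) (f : R -> R)
    (m_ge0 : 0 <= m) (m_lt_M : m < M) (f_superquadratic : superquadratic f)
    (x y : R) (x_in : m <= x <= M) (y_in : m <= y <= M) (x_neq_y : x <> y)
    (int_half : integrable_between 0 (1 / 2) (fun u => f (u * `|x - y|)))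
    (int_reflected : integrable_between x y (fun u => f (m + M - u)))
    (int_weighted :
       integrable_between 0 1 (fun u => (1 - u) * f (u * `|x - y|)))
    (int_f_beta : integrable_between x y (fun u => f u + 2 * beta m M f u))
    (int_beta : integrable_between x y (fun u => beta m M f u)) :
  (f (m + M - (x + y) / 2)
     + 2 * oriented_integral 0 (1 / 2) (fun u => f (u * `|x - y|))
   <= 1 / (y - x) * oriented_integral x y (fun u => f (m + M - u))
   /\
   1 / (y - x) * oriented_integral x y (fun u => f (m + M - u))
   <= f m + f M - (f x + f y) / 2 - (beta m M f x + beta m M f y)
      - 2 * oriented_integral 0 1 (fun u => (1 - u) * f (u * `|x - y|)))
  /\
  (f (m + M - (x + y) / 2)
     + 2 * oriented_integral 0 (1 / 2) (fun u => f (u * `|x - y|))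
   <= f m + f M
      - 1 / (y - x) * oriented_integral x y (fun u => f u + 2 * beta m M f u)
   /\
   f m + f M
      - 1 / (y - x) * oriented_integral x y (fun u => f u + 2 * beta m M f u)
   <= f m + f M - f ((x + y) / 2)
      - 2 / (y - x) * oriented_integral x y (fun u => beta m M f u)
      - 2 * oriented_integral 0 (1 / 2) (fun u => f (u * `|x - y|))).
Proof.
have /andP[mx xM] := x_in; have /andP[my yM] := y_in.
have x0 : 0 <= x by apply: le_trans mx.
have y0 : 0 <= y by apply: le_trans my.
have x'0 : 0 <= m + M - x by rewrite -addrA addr_ge0// subr_ge0.
have y'0 : 0 <= m + M - y by rewrite -addrA addr_ge0// subr_ge0.
have xy : x != y by exact/eqP.
have mI := @measurable_itv_clm R `[0, 1].
have h0 : 0 <= 1 / 2 :> R by lra.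
have iH := int_half; have iW := int_weighted.
rewrite /integrable_between min_l// max_r// in iH.
rewrite /integrable_between min_l// max_r// in iW.
have iR := integrable_unit xy int_reflected.
have iFB := integrable_unit xy int_f_beta.
have iB := integrable_unit xy int_beta.
pose z u := (y - x) * u + x.
have z_in u : u \in `[0, 1] -> m <= z u <= M.
  rewrite in_itv/= => /andP[u0 u1].
  have -> : z u = (1 - u) * x + u * y by rewrite /z; ring.
  have u1' : 0 <= 1 - u by rewrite subr_ge0.
  have := lerD (ler_wpM2l u1' mx) (ler_wpM2l u0 my).
  have := lerD (ler_wpM2l u1' xM) (ler_wpM2l u0 yM).
  by clear; move=> ? ?; apply/andP; split; lra.
have mercer_z u : u \in `[0, 1] ->
    f (m + M - z u) <= f m + f M - (f (z u) + 2 * beta m M f (z u)).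
  move=> /z_in zu.
  have := superquadratic_mercer f_superquadratic m_ge0 m_lt_M zu.
  by clear; lra.
(* The reflected segment runs from [m + M - x] to [m + M - y]. *)
have RE : (fun u => f (m + M - z u)) =
    (fun u => f (((m + M - y) - (m + M - x)) * u + (m + M - x))).
  by apply/funext => u; congr f; rewrite /z; ring.
(* The integrals with bounds [0], [1 / 2] and [1] have a known orientation; those
   from [x] to [y] stay folded, to be rewritten as means over [[0, 1]]. *)
rewrite /oriented_integral h0 ler01 -/(oriented_integral x y _).
rewrite -!/(oriented_integral x y _).
rewrite (_ : 2 / (y - x) * oriented_integral x y (fun u => beta m M f u) =
  2 * (1 / (y - x) * oriented_integral x y (fun u => beta m M f u))); last by ring.
rewrite !mean_oriented_integral//.
set I := \int[@clm R]_(u in `[0, 1]) f (m + M - ((y - x) * u + x)).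
set FB := \int[@clm R]_(u in `[0, 1])
  (f ((y - x) * u + x) + 2 * beta m M f ((y - x) * u + x)).
set B := \int[@clm R]_(u in `[0, 1]) beta m M f ((y - x) * u + x).
set H := \int[@clm R]_(u in `[0, 1 / 2]) f (u * `|x - y|).
set W := \int[@clm R]_(u in `[0, 1]) ((1 - u) * f (u * `|x - y|)).
have dE : `|(m + M - y) - (m + M - x)| = `|x - y| by congr `|_|; ring.
have IE : I = \int[@clm R]_(u in `[0, 1])
    f (((m + M - y) - (m + M - x)) * u + (m + M - x)).
  by rewrite -[in RHS]RE.
have iR' : (@clm R).-integrable `[0, 1] (EFin \o
    (fun u => f (((m + M - y) - (m + M - x)) * u + (m + M - x)))).
  by rewrite -RE.
have left : f (m + M - (x + y) / 2) + 2 * H <= I.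
  have := superquadratic_hermite_hadamard_left f_superquadratic x'0 y'0 iR'.
  rewrite dE -IE => /(_ iH).
  by rewrite (_ : (m + M - x + (m + M - y)) / 2 = m + M - (x + y) / 2)//; field.
have right : I <= (f (m + M - x) + f (m + M - y)) / 2 - 2 * W.
  have := superquadratic_hermite_hadamard_right f_superquadratic x'0 y'0 iR'.
  by rewrite dE -IE => /(_ iW).
have i1 := integrable_cst_segment (f m + f M) (@ler01 R).
have mercer : I <= f m + f M - FB.
  have -> : f m + f M - FB = \int[@clm R]_(u in `[0, 1])
      (f m + f M - (f (z u) + 2 * beta m M f (z u))).
    rewrite RintegralB// Rintegral_cst// [X in fine X]clm_segment//=.
    by rewrite subr0 mulr1.
  by apply: le_Rintegral => //; exact: (integrableB mI i1 iFB).
have iB2 : (@clm R).-integrable `[0, 1]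
    (EFin \o (fun u => 2 * beta m M f (z u))) by exact: (integrableZl mI 2 iB).
(* No integrability of [f] itself is assumed between [x] and [y]. *)
have fE : (fun u => f (z u)) =
    (fun u => f (z u) + 2 * beta m M f (z u) - 2 * beta m M f (z u)).
  by apply/funext => u; rewrite addrK.
have iz : (@clm R).-integrable `[0, 1] (EFin \o (fun u => f (z u))).
  by rewrite fE; exact: (integrableB mI iFB iB2).
have center : f ((x + y) / 2) + 2 * H <= FB - 2 * B.
  have -> : FB - 2 * B = \int[@clm R]_(u in `[0, 1]) f (z u).
    by rewrite [in RHS]fE RintegralB// RintegralZl.
  have := superquadratic_hermite_hadamard_left f_superquadratic x0 y0 iz.
  by rewrite (distrC y x) => /(_ iH).
have mercer_x := superquadratic_mercer f_superquadratic m_ge0 m_lt_M x_in.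
have mercer_y := superquadratic_mercer f_superquadratic m_ge0 m_lt_M y_in.
move: left right mercer center mercer_x mercer_y.
clearbody I FB B H W; clear => left right mercer center mercer_x mercer_y.
by split; split; lra.
Qed.
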